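(* For any curve $x:I\to M$ that is a solution of the equation of motion $$m\,\ddot x^\mu=e\,F^\mu{}_\nu\,\dot x^\nu-\tfrac23\,e^2\,\eta_{\rho\sigma}\ddot x^\rho\ddot x^\sigma\,\dot x^\mu ,$$ one has the following consequences, where $a^2=\eta(\ddot x,\ddot x)$ and $F_L^2$ is the square of the magnitude of the Lorentz force: (1) The Lorentz force is always spacelike or zero: $F_L^2\ge 0$. (2) In the case the Lorentz force is zero, the magnitude of the acceleration is zero: $F_L^2=0\Leftrightarrow a^2=0$. (3) If there is an external electromagnetic field, the acceleration is bounded by the strength of the corresponding Lorentz force.
   Context: $M$ is four-dimensional Minkowski spacetime with metric $\eta$ of signature $(-1,1,1,1)$, described in a global normal coordinate system in which $\eta$ is constant and diagonal; units with $c=1$. $m$ and $e$ are the (renormalized) mass and the charge of a point charged particle. $A_{max}>0$ is a constant, the maximal acceleration. World-lines are smooth future-directed curves parameterized by the proper time $\tau$ of the metric of maximal acceleration $g=(1-\epsilon)\eta$, with $\epsilon(\tau)=\eta(\ddot x,\ddot x)/A_{max}^2$, so that $g(\dot x,\dot x)=-1$; dots denote derivatives with respect to $\tau$. Accelerations satisfy $0\le\eta(\ddot x,\ddot x)<A_{max}^2$, and the regime considered is the perturbative one, $\epsilon\ll 1$. $F=F_{\mu\nu}\,dx^\mu\wedge dx^\nu$ is the external electromagnetic 2-form (antisymmetric components), $F^\mu{}_\nu=\eta^{\mu\rho}F_{\rho\nu}$, the Lorentz force is $e\,F^\mu{}_\nu\dot x^\nu$, and $F_L^2=e^2\,\eta_{\mu\nu}F^\mu{}_\rho\dot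 x^\rho F^\nu{}_\lambda\dot x^\lambda$; its strength (magnitude) is $F_L$. *)

(* Defs.v *)
From HB Require Import structures.
From mathcomp Require Import all_boot all_order all_algebra.
From mathcomp Require Import all_classical all_reals all_analysis.

Set Implicit Arguments.
Unset Strict Implicit.
Unset Printing Implicit Defensive.

Import Order.TTheory GRing.Theory Num.Theory.
Import numFieldNormedType.Exports.

Local Open Scope ring_scope.
Local Open Scope classical_set_scope.

(* Spacetime is identified with 'cV[R]_4 by the global coordinate system in
   which the metric is constant and diagonal; index 0 is the time index.
   Tangent vectors are columns of contravariant components. *)

Definition minkowski (R : realType) : 'M[R]_4 :=
  diag_mx (\row_(mu < 4) (if mu == 0 then -1 else 1)).

Definition bilin (R : realType) (g : 'M[R]_4) (v w : 'cV[R]_4) : R :=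
  \sum_mu \sum_nu g mu nu * v mu 0 * w nu 0.

Definition eta (R : realType) (v w : 'cV[R]_4) : R := bilin (minkowski R) v w.

Definition spacelike (R : realType) (v : 'cV[R]_4) : Prop := 0 < eta v v.

(* The derivatives are required on a neighbourhood of each point of I, so that
   at an endpoint belonging to I the curve is assumed to extend smoothly. *)
Definition smooth_curve (R : realType) (I : set R) (x : R -> 'cV[R]_4) : Prop :=
  forall (t : R) (n : nat), I t ->
    \forall s \near t, derivable (x^`(n)) s 1.

Definition velocity (R : realType) (x : R -> 'cV[R]_4) : R -> 'cV[R]_4 := x^`().

Definition acceleration (R : realType) (x : R -> 'cV[R]_4) : R -> 'cV[R]_4 :=
  x^`(2).

Definition acc2 (R : realType) (x : R -> 'cV[R]_4) (t : R) : R :=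
  eta (acceleration x t) (acceleration x t).

Definition epsilon (R : realType) (Amax : R) (x : R -> 'cV[R]_4) (t : R) : R :=
  acc2 x t / Amax ^+ 2.

(* The metric of maximal acceleration, evaluated along the curve x. *)
Definition max_acc_metric (R : realType) (Amax : R) (x : R -> 'cV[R]_4) (t : R)
  : 'M[R]_4 := (1 - epsilon Amax x t) *: minkowski R.

Record world_line (R : realType) (Amax : R) (I : set R) (x : R -> 'cV[R]_4)
  : Prop := WorldLine {
  wl_interval : is_interval I;
  wl_smooth : smooth_curve I x;
  wl_future : forall t, I t -> 0 < velocity x t 0 0;
  wl_acc : forall t, I t -> 0 <= acc2 x t < Amax ^+ 2;
  wl_proper_time : forall t, I t ->
    bilin (max_acc_metric Amax x t) (velocity x t) (velocity x t) = -1 }.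

Definition iter_derive (R : realType) (f : 'cV[R]_4 -> 'M[R]_4)
  (vs : seq 'cV[R]_4) : 'cV[R]_4 -> 'M[R]_4 :=
  foldr (fun v h => fun y => 'D_v h y) f vs.

Definition smooth_field (R : realType) (f : 'cV[R]_4 -> 'M[R]_4) : Prop :=
  forall vs : seq 'cV[R]_4, continuous (iter_derive f vs) /\
    forall y v, derivable (iter_derive f vs) y v.

(* F y mu nu is the covariant component F_{mu nu} at the point y. *)
Record two_form (R : realType) (F : 'cV[R]_4 -> 'M[R]_4) : Prop := TwoForm {
  tf_antisym : forall y mu nu, F y mu nu = - F y nu mu;
  tf_smooth : smooth_field F }.

(* F^mu_nu = eta^{mu rho} F_{rho nu} *)
Definition raise (R : realType) (A : 'M[R]_4) : 'M[R]_4 :=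
  invmx (minkowski R) *m A.

Definition lorentz_force (R : realType) (e : R) (F : 'cV[R]_4 -> 'M[R]_4)
  (x : R -> 'cV[R]_4) (t : R) : 'cV[R]_4 :=
  e *: (raise (F (x t)) *m velocity x t).

Definition FL2 (R : realType) (e : R) (F : 'cV[R]_4 -> 'M[R]_4)
  (x : R -> 'cV[R]_4) (t : R) : R :=
  e ^+ 2 * eta (raise (F (x t)) *m velocity x t) (raise (F (x t)) *m velocity x t).

Definition equation_of_motion (R : realType) (m e : R)
  (F : 'cV[R]_4 -> 'M[R]_4) (I : set R) (x : R -> 'cV[R]_4) : Prop :=
  forall t, I t ->
    m *: acceleration x t =
      lorentz_force e F x t - (2 / 3 * e ^+ 2 * acc2 x t) *: velocity x t.

(* Main.v *)
(* Write u for the velocity, a for the acceleration, w for the Lorentz force and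
   k = 2/3 e^2. Antisymmetry of F gives eta(u,w) = 0, and the proper-time
   normalisation together with eta(a,a) < Amax^2 makes u timelike. The orthogonal
   complement of a timelike vector is spacelike, whence (1). Contracting the
   equation of motion with u and with w gives
     F_L^2 = eta(w,w) = m^2 a^2 - k^2 a^4 eta(u,u),
   a sum of two nonnegative terms both vanishing when a^2 does, whence (2) and (3). *)
Require Import Defs.
From HB Require Import structures.
From mathcomp Require Import all_boot all_order all_algebra.
From mathcomp Require Import all_classical all_reals all_analysis.
From mathcomp Require Import ring lra.

Set Implicit Arguments.
Unset Strict Implicit.
Unset Printing Implicit Defensive.

Import Order.TTheory GRing.Theory Num.Theory.
Import numFieldNormedType.Exports.
Local Open Scope ring_scope.
Local Open Scope classical_set_scope.

(* The libraries imported after [Defs] shadow these two names. *)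
Local Notation eta := Defs.eta.
Local Notation minkowski := Defs.minkowski.

(** Matrix form of the double sum, from which bilinearity follows by matrix algebra. *)
Lemma bilinE (R : realType) (g : 'M[R]_4) (v w : 'cV[R]_4) :
  bilin g v w = (v^T *m g *m w) 0 0.
Proof.
rewrite /bilin exchange_big mxE; apply: eq_bigr => nu _ /=.
rewrite mxE mulr_suml; apply: eq_bigr => mu _.
by rewrite mxE (mulrC (g mu nu)).
Qed.

Lemma bilinZ (R : realType) (c : R) (g : 'M[R]_4) (v w : 'cV[R]_4) :
  bilin (c *: g) v w = c * bilin g v w.
Proof. by rewrite !bilinE -scalemxAr -scalemxAl mxE. Qed.

Lemma etaE (R : realType) (v w : 'cV[R]_4) :
  eta v w = - (v 0 0 * w 0 0) + v 1 0 * w 1 0 + v 2 0 * w 2 0 + v 3 0 * w 3 0.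
Proof.
rewrite /eta bilinE /minkowski mul_mx_diag mxE.
under eq_bigr => i _ do rewrite !mxE.
rewrite !big_ord_recl big_ord0 /= addr0 mulrN1 mulNr !mulr1 !addrA.
by congr (_ + v _ 0 * w _ 0 + v _ 0 * w _ 0 + v _ 0 * w _ 0); apply/val_inj.
Qed.

Lemma etaC (R : realType) (v w : 'cV[R]_4) : eta v w = eta w v.
Proof. by rewrite !etaE; ring. Qed.

Lemma etaDr (R : realType) (v w z : 'cV[R]_4) : eta v (w + z) = eta v w + eta v z.
Proof. by rewrite /eta !bilinE mulmxDr mxE. Qed.

Lemma etaZr (R : realType) (c : R) (v w : 'cV[R]_4) : eta v (c *: w) = c * eta v w.
Proof. by rewrite /eta !bilinE -scalemxAr mxE. Qed.

Lemma minkowski_unit (R : realType) : minkowski R \in unitmx.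
Proof.
rewrite unitmxE det_diag unitfE; apply/prodf_neq0 => i _.
by rewrite mxE; case: ifP => _; rewrite ?oppr_eq0 oner_eq0.
Qed.

(** Transposition fixes a 1x1 matrix, but changes the sign of this one because [A^T = - A]. *)
Lemma antisym_quadratic0 (R : realType) (A : 'M[R]_4) (u : 'cV[R]_4) :
  (forall mu nu, A mu nu = - A nu mu) -> u^T *m A *m u = 0.
Proof.
move=> hA; have AT : A^T = - A by apply/matrixP => i j; rewrite !mxE hA.
have : (u^T *m A *m u)^T = - (u^T *m A *m u).
  by rewrite !trmx_mul trmxK AT mulNmx mulmxN mulmxA.
move: (u^T *m A *m u) => q /matrixP/(_ 0 0); rewrite !mxE => q00.
by apply/matrixP => i j; rewrite !ord1 [RHS]mxE; lra.
Qed.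

(** The metric cancels the inverse metric inside [raise], leaving the quadratic form of [A] at
    [u]. *)
Lemma eta_raise_antisym (R : realType) (A : 'M[R]_4) (u : 'cV[R]_4) :
  (forall mu nu, A mu nu = - A nu mu) -> eta u (raise A *m u) = 0.
Proof.
move=> hA; rewrite /eta bilinE /raise !mulmxA mulmxK ?minkowski_unit//.
by rewrite antisym_quadratic0// mxE.
Qed.

(** Orthogonality equates [u0 * w0] with the Euclidean product of the spatial parts. Cauchy-Schwarz
    then bounds [u0 ^+ 2 * w0 ^+ 2] by [U * S], and [U < u0 ^+ 2] since [u] is timelike. *)
Lemma timelike_orthogonal (R : realType) (u w : 'cV[R]_4) :
  eta u u < 0 -> eta u w = 0 -> w = 0 \/ spacelike w.
Proof.
rewrite /spacelike !etaE.
set u0 := u 0 0; set u1 := u 1 0; set u2 := u 2 0; set u3 := u 3 0.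
set w0 := w 0 0; set w1 := w 1 0; set w2 := w 2 0; set w3 := w 3 0.
move=> uu uw.
set S := w1 ^+ 2 + w2 ^+ 2 + w3 ^+ 2.
set U := u1 ^+ 2 + u2 ^+ 2 + u3 ^+ 2.
have U_ge0 : 0 <= U by rewrite !addr_ge0 ?sqr_ge0.
have S_ge0 : 0 <= S by rewrite !addr_ge0 ?sqr_ge0.
have u0_gt : U < u0 ^+ 2 by rewrite /U; lra.
have cauchy : u0 ^+ 2 * w0 ^+ 2 <= U * S.
  have -> : u0 ^+ 2 * w0 ^+ 2 = (u1 * w1 + u2 * w2 + u3 * w3) ^+ 2.
    by rewrite -exprMn; congr (_ ^+ 2); lra.
  rewrite -subr_ge0.
  (* Lagrange's identity: the Cauchy-Schwarz defect is the squared norm of the cross product. *)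
  have -> : U * S - (u1 * w1 + u2 * w2 + u3 * w3) ^+ 2 =
      (u1 * w2 - u2 * w1) ^+ 2 + (u1 * w3 - u3 * w1) ^+ 2
      + (u2 * w3 - u3 * w2) ^+ 2 by rewrite /U /S; ring.
  by rewrite !addr_ge0 ?sqr_ge0.
have [S0|S_neq0] := eqVneq S 0; [left|right].
  have [w10 w20 w30] : [/\ w1 = 0, w2 = 0 & w3 = 0].
    have := (sqr_ge0 w1, sqr_ge0 w2, sqr_ge0 w3) => -[[h1 h2] h3].
    by split; apply/eqP; rewrite -sqrf_eq0; apply/eqP; rewrite /S in S0; lra.
  have w00 : w0 = 0.
    apply/eqP; rewrite -sqrf_eq0 eq_le sqr_ge0 andbT.
    by rewrite -(pmulr_rle0 _ (le_lt_trans U_ge0 u0_gt)) (le_trans cauchy)// S0 mulr0.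
  apply/matrixP => i j; rewrite ord1 [RHS]mxE.
  case: i => -[|[|[|[|//]]]] hi.
  - by rewrite -[RHS]w00; congr (w _ 0); apply/val_inj.
  - by rewrite -[RHS]w10; congr (w _ 0); apply/val_inj.
  - by rewrite -[RHS]w20; congr (w _ 0); apply/val_inj.
  - by rewrite -[RHS]w30; congr (w _ 0); apply/val_inj.
have S_gt0 : 0 < S by rewrite lt_neqAle eq_sym S_neq0.
suff : w0 ^+ 2 < S by rewrite /S; lra.
(* After multiplication by [u0 ^+ 2 > 0], the chain is
   [u0 ^+ 2 * w0 ^+ 2 <= U * S < u0 ^+ 2 * S]. *)
rewrite -(ltr_pM2l (le_lt_trans U_ge0 u0_gt)) (le_lt_trans cauchy)//.
by rewrite ltr_pM2r.
Qed.

(** The normalisation says that [1 - epsilon] times [eta u u] is -1, and the acceleration bound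
    makes that factor positive. *)
Lemma velocity_timelike (R : realType) (Amax : R) (I : set R)
    (x : R -> 'cV[R]_4) (t : R) :
  0 < Amax -> world_line Amax I x -> I t -> eta (velocity x t) (velocity x t) < 0.
Proof.
move=> Amax_gt0 x_wl It.
have /andP[_ acc_lt] := wl_acc x_wl It.
have := wl_proper_time x_wl It; rewrite bilinZ -/(eta _ _) => norm.
have eps_lt1 : 0 < 1 - epsilon Amax x t.
  by rewrite subr_gt0 /epsilon ltr_pdivrMr ?exprn_gt0// mul1r.
by rewrite -(pmulr_rlt0 _ eps_lt1) norm ltrN10.
Qed.

Lemma velocity_lorentz_force (R : realType) (e : R) (F : 'cV[R]_4 -> 'M[R]_4)
    (x : R -> 'cV[R]_4) (t : R) :
  two_form F -> eta (velocity x t) (lorentz_force e F x t) = 0.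
Proof.
move=> F_form; rewrite etaZr eta_raise_antisym ?mulr0// => mu nu.
exact: tf_antisym F_form _ _ _.
Qed.

Lemma FL2E (R : realType) (e : R) (F : 'cV[R]_4 -> 'M[R]_4)
    (x : R -> 'cV[R]_4) (t : R) :
  FL2 e F x t = eta (lorentz_force e F x t) (lorentz_force e F x t).
Proof. by rewrite /lorentz_force etaZr etaC etaZr mulrA -expr2. Qed.

Lemma FL2_acc2 (R : realType) (m e : R) (F : 'cV[R]_4 -> 'M[R]_4) (I : set R)
    (x : R -> 'cV[R]_4) (t : R) :
  two_form F -> equation_of_motion m e F I x -> I t ->
  FL2 e F x t = m ^+ 2 * acc2 x t
    - (2 / 3 * e ^+ 2 * acc2 x t) ^+ 2 * eta (velocity x t) (velocity x t).
Proof.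
move=> F_form x_sol It; rewrite FL2E.
have := velocity_lorentz_force e x t F_form; have := x_sol t It.
set w := lorentz_force e F x t; set u := velocity x t; set a := acceleration x t.
set b := 2 / 3 * e ^+ 2 * acc2 x t.
(* Substituting [w = m *: a + b *: u] also turns the orthogonality of [u] and [w] into a formula for
   [m * eta u a]. *)
move=> /eqP; rewrite eq_sym subr_eq => /eqP ->.
rewrite !etaDr !etaZr => ua.
have {}ua : m * eta u a = - (b * eta u u) by lra.
rewrite ![eta (_ + _) _]etaC !etaDr !etaZr (etaC a u) ua addNr mulr0 addr0.
(* Regrouping exposes the product [m * eta u a], whose value is given by [ua]. *)
have -> : m * (m * eta a a + b * eta u a) = m ^+ 2 * eta a a + b * (m * eta u a).
  by ring.
rewrite ua /acc2 -/a; ring.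
Qed.

Theorem proposition6p2 (R : realType) (m e Amax : R)
    (F : 'cV[R]_4 -> 'M[R]_4) (I : set R) (x : R -> 'cV[R]_4)
    (m_gt0 : 0 < m) (Amax_gt0 : 0 < Amax)
    (F_form : two_form F)
    (x_wl : world_line Amax I x)
    (x_sol : equation_of_motion m e F I x) :
  [/\ (* (1) *)
      forall t, I t ->
        (lorentz_force e F x t = 0 \/ spacelike (lorentz_force e F x t)) /\
        0 <= FL2 e F x t,
      (* (2) *)
      forall t, I t -> (FL2 e F x t = 0 <-> acc2 x t = 0)
    & (* (3) *)
      (exists y, F y != 0) ->
      forall t, I t -> Num.sqrt (acc2 x t) <= Num.sqrt (FL2 e F x t) / m ].
Proof.
have m2_gt0 : 0 < m ^+ 2 by rewrite exprn_gt0.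
have acc_ge0 t : I t -> 0 <= acc2 x t by move=> /(wl_acc x_wl)/andP[].
(* This gives the sign in (1), the forward implication in (2) and the bound in (3); the discarded
   term is nonnegative because the velocity is timelike. *)
have FL2_ge t : I t -> m ^+ 2 * acc2 x t <= FL2 e F x t.
  move=> It; rewrite (FL2_acc2 F_form x_sol It) lerDl oppr_ge0.
  by rewrite mulr_ge0_le0 ?sqr_ge0// ltW// (velocity_timelike Amax_gt0 x_wl It).
split=> [t It|t It|_ t It].
- split; last by rewrite (le_trans _ (FL2_ge t It))// mulr_ge0 ?acc_ge0// ltW.
  apply: (timelike_orthogonal (velocity_timelike Amax_gt0 x_wl It)).
  exact: velocity_lorentz_force.
- split=> [FL0|acc0]; last first.
    by rewrite (FL2_acc2 F_form x_sol It) acc0 !mulr0 expr0n mul0r subr0.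
  apply/eqP; rewrite eq_le acc_ge0// andbT -(pmulr_rle0 _ m2_gt0) -FL0.
  exact: FL2_ge.
(* Writing [m] as the square root of [m ^+ 2] reduces the bound to monotonicity of the square
   root. *)
- rewrite ler_pdivlMr// -{1}(ger0_norm (ltW m_gt0)) -sqrtr_sqr mulrC.
  by rewrite -sqrtrM ?ler_wsqrtr ?FL2_ge ?ltW.
Qed.
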